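(* Let $G$ be an AH-algebra (the directed group of an e-ring $(R,E)$). A subset $H$ of $G$ is a C-block of $G$ if and only if $H$ is a maximal set of pairwise commuting elements of $G$.
   Context: **e-rings.** An e-ring is a pair $(R,E)$ where $R$ is an associative ring with unity $1\neq 0$ and $E\subseteq R$ is a subset (elements called effects) such that $0,1\in E$; $e\in E\Rightarrow 1-e\in E$; and the set $E^{+}$ of all finite sums $e_1+\cdots+e_n$ with $e_i\in E$ satisfies, for all $a,b\in E^{+}$: (i) $-a\in E^{+}\Rightarrow a=0$; (ii) $1-a\in E^{+}\Rightarrow a\in E$; (iii) $ab=ba\Rightarrow ab\in E^{+}$; (iv) $aba\in E^{+}$; (v) $aba=0\Rightarrow ab=ba=0$; (vi) $(a-b)^2\in E^{+}$. The directed group of $(R,E)$ is $G:=E^{+}-E^{+}=\{a-b: a,b\in E^{+}\}$, a subgroup of the additive group of $R$, partially ordered by $g\leq h\Leftrightarrow h-g\in E^{+}$. The set of projections is $P:=\{p\in G: p=p^2\}$. Products of elements of $G$ are taken in $R$. **Commutants.** For $g,h\in G$, $gCh$ means $gh=hg$. For $A\subseteq G$, $C(A):=\{g\in G: gCa\ \forall a\in A\}$ and $CC(A):=C(C(A))$. **AH-algebra.** $G$ is an AH-algebra iff: (1) there is an effect $\frac12\in E$ with $\frac12+\frac12=1$; (2) quadratic annihilation (QA): for all $g,h\in G$, $gh^2g=0\Rightarrow gh=hg=0$; (3) commutative Vigier (CV) property: every ascending sequence $g_1\leq g_2\leq\cdots$ of pairwise commuting elements of $G$ that is bounded above in $G$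 has a supremum $g$ in $G$, and $g\in CC(\{g_n:n\in\mathbb N\})$. In an AH-algebra, $P$ (with the order of $G$) is an orthomodular lattice with orthocomplementation $p\mapsto 1-p$. **Blocks and C-blocks.** Elements $p,q\in P$ are (Mackey) compatible iff there are pairwise orthogonal $p_1,q_1,r\in P$ (orthogonal: $p\le 1-q$) with $p=p_1\vee r=p_1+r$ and $q=q_1\vee r=q_1+r$; in the present setting this is equivalent to $pq=qp$. A block of $P$ is a maximal set of pairwise compatible elements of $P$; equivalently, a subset $B\subseteq P$ with $B=C(B)\cap P$. A C-block in $G$ is a subgroup of $G$ of the form $C(B)$ where $B$ is a block in $P$. *)

(* Defs.v *)
From HB Require Import structures.
From mathcomp Require Import all_boot all_order all_algebra.
From mathcomp Require Import boolp classical_sets.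

Set Implicit Arguments.
Unset Strict Implicit.
Unset Printing Implicit Defensive.

Import GRing.Theory.
Local Open Scope classical_set_scope.
Local Open Scope ring_scope.

(* [A] is an inclusion-maximal element of the family [F] of subsets of [T]. *)
Definition maximal_set (T : Type) (F : set (set T)) (A : set T) : Prop :=
  F A /\ forall B : set T, F B -> A `<=` B -> B `<=` A.

Section ERing.
Variables (R : nzRingType) (E : set R).

(* E^+.  Allowing the empty sum changes nothing, since 0 is an effect. *)
Definition effect_sums : set R :=
  [set a | exists s : seq R, (forall e, e \in s -> E e) /\ a = \sum_(e <- s) e].

Record is_ering : Prop := IsERing {
  ering_0 : E 0;
  ering_1 : E 1;
  ering_compl : forall e, E e -> E (1 - e);
  ering_opp : forall a, effect_sums a -> effect_sums (- a) -> a = 0;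
  ering_le1 : forall a, effect_sums a -> effect_sums (1 - a) -> E a;
  ering_mul : forall a b, effect_sums a -> effect_sums b ->
    a * b = b * a -> effect_sums (a * b);
  ering_quad : forall a b, effect_sums a -> effect_sums b ->
    effect_sums (a * b * a);
  ering_quad0 : forall a b, effect_sums a -> effect_sums b ->
    a * b * a = 0 -> a * b = 0 /\ b * a = 0;
  ering_sqr : forall a b, effect_sums a -> effect_sums b ->
    effect_sums ((a - b) ^+ 2)
}.

(* The underlying set of G = E^+ - E^+. *)
Definition directed_group : set R :=
  [set g | exists a b, [/\ effect_sums a, effect_sums b & g = a - b]].

Definition dg_le (g h : R) : Prop := effect_sums (h - g).

Definition projections : set R :=
  [set p | directed_group p /\ p = p ^+ 2].

(* [commutant] is taken inside G, not inside the whole ring R. *)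
Definition commutant (A : set R) : set R :=
  [set g | directed_group g /\ forall a, A a -> GRing.comm g a].

Definition bicommutant (A : set R) : set R := commutant (commutant A).

Definition dg_supremum (u : nat -> R) (s : R) : Prop :=
  [/\ directed_group s,
      forall n, dg_le (u n) s
    & forall h, directed_group h -> (forall n, dg_le (u n) h) -> dg_le s h].

Definition quadratic_annihilation : Prop :=
  forall g h, directed_group g -> directed_group h ->
    g * h ^+ 2 * g = 0 -> g * h = 0 /\ h * g = 0.

Definition commutative_Vigier : Prop :=
  forall u : nat -> R,
    (forall n, directed_group (u n)) ->
    (forall n, dg_le (u n) (u n.+1)) ->
    (forall m n, GRing.comm (u m) (u n)) ->
    (exists2 b, directed_group b & forall n, dg_le (u n) b) ->
    exists2 s, dg_supremum u s & bicommutant (range u) s.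

Definition is_AH_algebra : Prop :=
  [/\ exists2 h, E h & h + h = 1, quadratic_annihilation & commutative_Vigier].

Definition orthogonal_proj (p q : R) : Prop := dg_le p (1 - q).

(* [s] is the join of [p] and [q] in the poset of projections. *)
Definition is_join_proj (p q s : R) : Prop :=
  [/\ projections s, dg_le p s, dg_le q s
    & forall t, projections t -> dg_le p t -> dg_le q t -> dg_le s t].

Definition Mackey_compatible (p q : R) : Prop :=
  exists p1 q1 r : R,
    [/\ [/\ projections p1, projections q1 & projections r],
        [/\ orthogonal_proj p1 q1, orthogonal_proj p1 r & orthogonal_proj q1 r],
        is_join_proj p1 r p /\ p = p1 + r
      & is_join_proj q1 r q /\ q = q1 + r].

Definition pairwise_compatible : set (set R) :=
  [set B | B `<=` projections /\ forall p q, B p -> B q -> Mackey_compatible p q].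

Definition is_block (B : set R) : Prop := maximal_set pairwise_compatible B.

Definition is_C_block (H : set R) : Prop :=
  zmod_closed [in H] /\ exists2 B, is_block B & H = commutant B.

Definition pairwise_commuting : set (set R) :=
  [set A | A `<=` directed_group /\ forall g h, A g -> A h -> GRing.comm g h].

End ERing.

(* Main.v *)
(* Everything reduces to the following: an element [z] of [G] that commutes with
   all projections in [CC(g)] commutes with [g].  The bicommutant [CC(e)] of an
   effect [e] is a commutative ring whose positive cone admits suprema of bounded
   ascending sequences.  There, suprema produce square roots and annihilating
   projections, and from these a projection [c] with [0 <= 2 e - c <= 1].
   Iterating [e |-> 2 e - c] expands [e] in binary, [e = sum_k c_k / 2 ^ k], with
   all [c_k] in [CC(e)]; the partial sums ascend to [e], and the Vigier property
   places their supremum in their bicommutant.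

   Commutation with projections thus controls commutation in [G], and the
   correspondence is [B |-> C(B)], [H |-> H & P] between the [B = C(B) & P] and
   the [H = C(H)]. *)
Require Import Defs.
From HB Require Import structures.
From mathcomp Require Import all_boot all_order all_algebra.
From mathcomp Require Import boolp classical_sets.
From mathcomp Require Import ring.

Set Implicit Arguments.
Unset Strict Implicit.
Unset Printing Implicit Defensive.

Import GRing.Theory.
Local Open Scope classical_set_scope.
Local Open Scope ring_scope.

(** * Commutative subrings as ring types *)

Record commutative_subring (R : nzRingType) (S : set R) : Prop := {
  csub_closed : subring_closed [in S];
  csub_comm : forall x y, S x -> S y -> GRing.comm x y
}.

Section SubringType.
Variables (R : nzRingType) (S : set R) (hS : commutative_subring S).

(** The proof [h] is a parameter of the type so that the ring structures declared below can refer to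
    it. *)
Record csub_type (h : commutative_subring S) :=
  CSub { csub_val : R; csub_valP : csub_val \in [in S] }.

HB.instance Definition _ := [isSub for @csub_val hS].
HB.instance Definition _ := [Choice of csub_type hS by <:].
HB.instance Definition _ :=
  GRing.SubChoice_isSubNzRing.Build R [in S] (csub_type hS) (csub_closed hS).

Lemma csub_mulC : @commutative (csub_type hS) _ *%R.
Proof.
move=> [x Sx] [y Sy]; apply: val_inj; rewrite !rmorphM /=.
by apply: (csub_comm hS); exact: set_mem.
Qed.

HB.instance Definition _ :=
  GRing.PzRing_hasCommutativeMul.Build (csub_type hS) csub_mulC.
End SubringType.

(** * Monotone complete cones in commutative rings *)

(** An abstract copy of the positive elements of a bicommutant: [P (b - a)] stands for [a <= b], and
    over a [comNzRingType] the [ring] tactic is available. *)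
Record monotone_complete_cone (T : comNzRingType) (P : set T) : Prop := {
  mcc_add : forall a b, P a -> P b -> P (a + b);
  mcc_mul : forall a b, P a -> P b -> P (a * b);
  mcc_sqr : forall a, P (a ^+ 2);
  mcc_anti : forall a, P a -> P (- a) -> a = 0;
  mcc_reduced : forall a : T, a ^+ 2 = 0 -> a = 0;
  mcc_half : exists h : T, h + h = 1;
  mcc_sup : forall u : nat -> T, (forall n, P (u n.+1 - u n)) ->
    (exists b, forall n, P (b - u n)) ->
    exists2 s, forall n, P (s - u n)
      & forall b, (forall n, P (b - u n)) -> P (b - s)
}.

Section MonotoneCompleteCone.
Variables (T : comNzRingType) (P : set T).
Hypothesis hP : monotone_complete_cone P.

Lemma mcc_0 : P 0.
Proof. by have := mcc_sqr hP 0; rewrite expr0n. Qed.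

Lemma mcc_1 : P 1.
Proof. by have := mcc_sqr hP 1; rewrite expr1n. Qed.

Lemma mcc_exp a n : P a -> P (a ^+ n).
Proof.
move=> Pa; elim: n => [|n IHn]; first by rewrite expr0; exact: mcc_1.
by rewrite exprS; exact: mcc_mul.
Qed.

Lemma mcc_idem q : q * q = q -> P q.
Proof. by move=> qq; rewrite -qq -expr2; exact: mcc_sqr. Qed.

Lemma mcc_half_pos : exists2 h : T, P h & h + h = 1.
Proof.
have [h hh] := mcc_half hP; exists h => //.
have -> : h = h ^+ 2 + h ^+ 2 by rewrite expr2 -mulrDl hh mul1r.
by apply: (mcc_add hP); exact: mcc_sqr.
Qed.

(* For [0 <= e <= 1], [q] is the infimum of the powers [(1 - e) ^+ n]. *)
Lemma annihilator_proj e : P e -> P (1 - e) ->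
  exists q, [/\ q * q = q, e * q = 0
    & forall x, P x -> P (1 - x) -> e * x = 0 -> x * q = x].
Proof.
move=> Pe Pf; set f := 1 - e in Pf.
have fe : f = 1 - e by [].
have [|| s sub slub] := mcc_sup hP (u := fun n => - f ^+ n).
- move=> n; have -> : - f ^+ n.+1 - - f ^+ n = e * f ^+ n by rewrite exprS fe; ring.
  by apply: mcc_mul => //; exact: mcc_exp.
- by exists 0 => n; rewrite sub0r opprK; exact: mcc_exp.
pose q := - s.
have qle n : P (f ^+ n - q) by have := sub n; rewrite /q !opprK addrC.
(* [q] is the greatest lower bound of the powers: if [q + t] is a lower bound too, then [t <= 0]. *)
have squeeze t : (forall n, P (f ^+ n - q - t)) -> P (- t).
  move=> tle; have -> : - t = (s - t) - s by ring.
  apply: slub => n; have -> : s - t - - f ^+ n = f ^+ n - q - t by rewrite /q; ring.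
  exact: tle.
have Pq : P q.
  rewrite /q -sub0r; apply: slub => n; rewrite sub0r opprK; exact: mcc_exp.
have Pq1 : P (1 - q) by have := qle 0%N; rewrite expr0.
have eq0 : e * q = 0.
  apply: (mcc_anti hP); first exact: mcc_mul.
  apply: squeeze => n.
  have -> : f ^+ n - q - e * q = (f ^+ n.+1 - q) + e * (f ^+ n - q).
    by rewrite exprS fe; ring.
  by apply: (mcc_add hP) => //; exact: mcc_mul.
have fix_pow x n : e * x = 0 -> x * f ^+ n = x.
  move=> ex0; elim: n => [|n IHn]; first by rewrite expr0 mulr1.
  by rewrite exprSr mulrA IHn fe mulrBr mulr1 (mulrC x) ex0 subr0.
have fixed x : P x -> P (1 - x) -> e * x = 0 -> x * q = x.
  move=> Px Px1 ex0; apply/esym/eqP; rewrite -subr_eq0; apply/eqP.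
  apply: (mcc_anti hP).
    by rewrite -[X in X - _]mulr1 -mulrBr; exact: mcc_mul.
  apply: squeeze => n.
  have -> : f ^+ n - q - (x - x * q) = (1 - x) * (f ^+ n - q).
    by rewrite mulrBl mul1r mulrBr (fix_pow _ n ex0).
  exact: mcc_mul.
(* Idempotence of [q] is [fixed] at [x = q]. *)
by exists q; split=> //; exact: fixed.
Qed.

(* [1 - x] is the limit of the ascending iterates of [y |-> (1 - a + y ^+ 2) / 2]. *)
Lemma square_root a : P a -> P (1 - a) ->
  exists x, [/\ P x, P (1 - x) & x ^+ 2 = a].
Proof.
move=> Pa Pb; set b := 1 - a in Pb.
have [h Ph hh] := mcc_half_pos.
have halfK z : h * (z + z) = z by rewrite mulrDr -mulrDl hh mul1r.
pose fix y n := if n is m.+1 then h * (b + y m ^+ 2) else 0.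
have Py n : P (y n).
  elim: n => [|n IHn] /=; first exact: mcc_0.
  by apply: (mcc_mul hP) => //; apply: (mcc_add hP) => //; exact: mcc_sqr.
have Py1 n : P (1 - y n).
  elim: n => [|n IHn] /=; first by rewrite subr0; exact: mcc_1.
  have -> : 1 - h * (b + y n ^+ 2) = h * (a + (1 - y n) * (1 + y n)).
    by rewrite -[X in X - _](halfK 1) /b; ring.
  apply: (mcc_mul hP) => //; apply: (mcc_add hP) => //; apply: (mcc_mul hP) => //.
  by apply: (mcc_add hP) => //; exact: mcc_1.
have yS n : P (y n.+1 - y n).
  elim: n => [|n IHn] /=.
    by rewrite subr0 expr0n addr0; exact: mcc_mul.
  have -> : h * (b + (h * (b + y n ^+ 2)) ^+ 2) - h * (b + y n ^+ 2) =
            h * ((y n.+1 - y n) * (y n.+1 + y n)) by rewrite /=; ring.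
  by do 2![apply: (mcc_mul hP) => //]; apply: (mcc_add hP).
have [|s sub slub] := mcc_sup hP yS; first by exists 1.
have Ps : P s by have := sub 0%N; rewrite /= subr0.
have Ps1 : P (1 - s) by exact: slub.
have fixs : s = h * (b + s ^+ 2).
  apply/eqP; rewrite -subr_eq0; apply/eqP; apply: (mcc_anti hP).
    (* On [[0, 1]] the iterated map increases by at most as much as its argument, so adding
       [s - h * (b + s ^+ 2)] to [s] leaves an upper bound of all [y n]. *)
    have -> : s - h * (b + s ^+ 2) = s + (s - h * (b + s ^+ 2)) - s by ring.
    apply: slub => n.
    rewrite addrAC -[X in X + _]halfK.
    have -> : h * (s - y n + (s - y n)) + (s - h * (b + s ^+ 2)) =
       (s - y n.+1) + h * ((s - y n) * ((1 - s) + (1 - y n))) by rewrite /=; ring.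
    apply: (mcc_add hP) => //; do 2![apply: (mcc_mul hP) => //].
    exact: (mcc_add hP).
  (* Conversely, the image of [s] bounds [y 0 = 0] trivially and [y n.+1] by monotonicity of the
     map. *)
  rewrite opprB; apply: slub => -[|n] /=.
    by rewrite subr0; apply: (mcc_mul hP) => //; apply: (mcc_add hP) => //; exact: mcc_sqr.
  have -> : h * (b + s ^+ 2) - h * (b + y n ^+ 2) = h * ((s - y n) * (s + y n)) by ring.
  by do 2![apply: (mcc_mul hP) => //]; apply: (mcc_add hP).
exists (1 - s); split=> //; first by rewrite subKr.
have : s + s = b + s ^+ 2 by rewrite {1 2}fixs -mulrDl hh mul1r.
rewrite /b => /eqP; rewrite -subr_eq0 => /eqP E0.
apply/eqP; rewrite -subr_eq0 -oppr_eq0 -E0; apply/eqP; ring.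
Qed.

(** Here [x] plays the role of the absolute value of [g], and [u], [v] are its positive and negative
    parts. As [u v = 0], the annihilating projection [q] of [u ^+ 2] kills [u] and fixes [v], so
    that [g] is [x] on [1 - q] and [- x] on [q]. *)
Lemma sign_proj g : P (1 - g) -> P (1 + g) ->
  exists c, [/\ c * c = c, P (g * c) & P (- (g * (1 - c)))].
Proof.
move=> Pg1 Pg2.
have [h Ph hh] := mcc_half_pos.
have halfK z : h * (z + z) = z by rewrite mulrDr -mulrDl hh mul1r.
have [||x [Px Px1 xx]] := @square_root (g ^+ 2); first exact: mcc_sqr.
  have -> : 1 - g ^+ 2 = (1 - g) * (1 + g) by ring.
  exact: mcc_mul.
pose u := h * (x + g); pose v := h * (x - g).
have P1x : P (1 + x) by apply: (mcc_add hP) => //; exact: mcc_1.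
have sqr_le1 k : P (1 - k) -> P (1 + k) -> P (1 - (h * (x + k)) ^+ 2).
  move=> Pk1 Pk2.
  have -> : 1 - (h * (x + k)) ^+ 2 =
            (h * ((1 - x) + (1 - k))) * (h * ((1 + x) + (1 + k))).
    have -> : h * ((1 - x) + (1 - k)) = h * (1 + 1) - h * (x + k) by ring.
    have -> : h * ((1 + x) + (1 + k)) = h * (1 + 1) + h * (x + k) by ring.
    by rewrite halfK; ring.
  by do 2![apply: (mcc_mul hP)]; rewrite ?Ph //; apply: (mcc_add hP).
have uv0 : u * v = 0.
  have -> : u * v = h ^+ 2 * (x ^+ 2 - g ^+ 2) by rewrite /u /v; ring.
  by rewrite xx subrr mulr0.
have uDv : u + v = x by rewrite -[RHS]halfK /u /v; ring.
have uBv : u - v = g by rewrite -[RHS]halfK /u /v; ring.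
(* Squares are used because their positivity is immediate; [mcc_reduced] then descends from [u ^+ 2]
   and [v ^+ 2] to [u] and [v]. *)
have [||q [qq uuq qmax]] := @annihilator_proj (u ^+ 2); first exact: mcc_sqr.
  exact: sqr_le1.
have uq : u * q = 0 by apply: (mcc_reduced hP); rewrite exprMn [q ^+ 2]expr2 qq.
have vq : v * q = v.
  have vvq : v ^+ 2 * q = v ^+ 2.
    apply: qmax; first exact: mcc_sqr.
      by apply: sqr_le1; rewrite ?opprK.
    by rewrite -exprMn uv0 expr0n.
  apply/esym/eqP; rewrite -subr_eq0; apply/eqP; apply: (mcc_reduced hP).
  have -> : (v - v * q) ^+ 2 = v ^+ 2 - v ^+ 2 * q - (v ^+ 2 * q - v ^+ 2 * (q * q)).
    by ring.
  by rewrite qq vvq !subrr.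
have gq : g * q = - (x * q) by rewrite -uBv -uDv mulrBl mulrDl uq sub0r add0r.
have gq' : g * (1 - q) = x * (1 - q).
  by rewrite !mulrBr gq !mulr1 -uBv -uDv mulrDl uq vq; ring.
have cc : (1 - q) * (1 - q) = 1 - q.
  have -> : (1 - q) * (1 - q) = 1 - q - (q - q * q) by ring.
  by rewrite qq subrr subr0.
exists (1 - q); split=> //.
  by rewrite gq'; apply: (mcc_mul hP) => //; exact: mcc_idem.
rewrite subKr gq opprK.
by apply: (mcc_mul hP) => //; exact: mcc_idem.
Qed.

(** The digit [c] is the sign projection of [2 e - 1]: the remainder [2 e - c] equals [2 e - 1 >= 0]
    on [c] and [2 e <= 1] on [1 - c]. *)
Lemma bisection_proj e : P e -> P (1 - e) ->
  exists c, [/\ c * c = c, P (e + e - c) & P (1 - (e + e - c))].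
Proof.
move=> Pe Pe1.
have [||c [cc Pc Pc']] := @sign_proj (e + e - 1).
- have -> : 1 - (e + e - 1) = (1 - e) + (1 - e) by ring.
  exact: (mcc_add hP).
- rewrite addrC subrK; exact: (mcc_add hP).
have cc' : (1 - c) * (1 - c) = 1 - c.
  have -> : (1 - c) * (1 - c) = 1 - c - (c - c * c) by ring.
  by rewrite cc subrr subr0.
exists c; split=> //.
  have -> : e + e - c = (e + e - 1) * c + (e + e) * (1 - c) by ring.
  apply: (mcc_add hP) => //; apply: (mcc_mul hP); first exact: (mcc_add hP).
  exact: mcc_idem.
have -> : 1 - (e + e - c) = (1 - e + (1 - e)) * c + - ((e + e - 1) * (1 - c)) by ring.
apply: (mcc_add hP) => //; apply: (mcc_mul hP); first exact: (mcc_add hP).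
exact: mcc_idem.
Qed.

End MonotoneCompleteCone.

(** * Order and arithmetic of the directed group *)

Section ERingTheory.
Variables (R : nzRingType) (E : set R).
Hypothesis hE : is_ering E.
Hypothesis hAH : is_AH_algebra E.

Local Notation Pos := (effect_sums E).
Local Notation G := (directed_group E).
Local Notation P := (projections E).
Local Notation C := (commutant E).
Local Notation CC := (bicommutant E).

Lemma effect_pos e : E e -> Pos e.
Proof.
move=> Ee; exists [:: e]; split=> [x|]; last by rewrite big_seq1.
by rewrite inE => /eqP->.
Qed.

Lemma posD a b : Pos a -> Pos b -> Pos (a + b).
Proof.
move=> [s [Es ->]] [t [Et ->]]; exists (s ++ t); rewrite big_cat; split=> // e.
by rewrite mem_cat => /orP[/Es|/Et].
Qed.

Lemma pos0 : Pos 0. Proof. exact/effect_pos/(ering_0 hE). Qed.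
Lemma pos1 : Pos 1. Proof. exact/effect_pos/(ering_1 hE). Qed.

Lemma pos_anti a : Pos a -> Pos (- a) -> a = 0.
Proof. exact: (ering_opp hE). Qed.

Lemma pos_nat n : Pos n%:R.
Proof. by elim: n => [|n IHn]; [exact: pos0 | rewrite mulrS; exact: posD pos1 IHn]. Qed.

Lemma pos_dg a : Pos a -> G a.
Proof. by move=> Pa; exists a, 0; split; rewrite ?subr0 //; exact: pos0. Qed.

Lemma dg0 : G 0. Proof. exact/pos_dg/pos0. Qed.
Lemma dg1 : G 1. Proof. exact/pos_dg/pos1. Qed.

Lemma dgN g : G g -> G (- g).
Proof. by move=> [a [b [Pa Pb ->]]]; exists b, a; rewrite opprB. Qed.

Lemma dgD g k : G g -> G k -> G (g + k).
Proof.
move=> [a [b [Pa Pb ->]]] [c [d [Pc Pd ->]]].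
by exists (a + c), (b + d); split; [exact: posD..|rewrite opprD addrACA].
Qed.

Lemma dgB g k : G g -> G k -> G (g - k).
Proof. by move=> Gg Gk; apply: dgD => //; exact: dgN. Qed.

Lemma pos_sqr g : G g -> Pos (g ^+ 2).
Proof. by move=> [a [b [Pa Pb ->]]]; exact: (ering_sqr hE). Qed.

Lemma proj_pos p : P p -> Pos p.
Proof. by move=> [Gp ->]; exact: pos_sqr. Qed.

Lemma projC p : P p -> P (1 - p).
Proof.
move=> [Gp pp]; split; first exact: dgB dg1 Gp.
rewrite expr2 mulrBl mul1r mulrBr mulr1 -expr2 -pp subrr subr0 //.
Qed.

(** One half is central: [x h = (h + h) x h = h x (h + h) = h x]. *)
Lemma half_exists : exists h : R,
  [/\ E h, h + h = 1 & forall x, GRing.comm x h].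
Proof.
have [[h Eh hh] _ _] := hAH; exists h; split=> // x.
by rewrite /GRing.comm -[LHS]mul1r -{1}hh mulrDl -mulrDr -mulrDr hh mulr1.
Qed.

Section Half.
Variable h : R.
Hypotheses (Eh : E h) (hh : h + h = 1) (hC : forall x, GRing.comm x h).

Lemma halfK x : h * x + h * x = x.
Proof. by rewrite -mulrDl hh mul1r. Qed.

Lemma pos_halfX n a : Pos a -> Pos (h ^+ n * a).
Proof.
move=> Pa; elim: n => [|n IHn]; first by rewrite expr0 mul1r.
rewrite exprS -mulrA; apply: (ering_mul hE) => //; first exact: effect_pos.
by rewrite hC.
Qed.

Lemma dg_halfX n g : G g -> G (h ^+ n * g).
Proof.
move=> [a [b [Pa Pb ->]]]; exists (h ^+ n * a), (h ^+ n * b).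
by rewrite mulrBr; split=> //; exact: pos_halfX.
Qed.

Lemma halfX_nat n : h ^+ n * (2 ^ n)%:R = 1.
Proof.
elim: n => [|n IHn]; first by rewrite expr0 expn0 mulr1.
rewrite exprS expnS natrM -mulrA (mulrA (h ^+ n)) (commr_nat (h ^+ n) 2).
by rewrite -(mulrA 2) IHn mulr1 mulr_natr.
Qed.

Lemma comm_halfX n x : GRing.comm x (h ^+ n).
Proof. exact: commrX. Qed.

(* Polarization: [x y] is half of [(x + y) ^+ 2 - x ^+ 2 - y ^+ 2]. *)
Lemma dgM x y : G x -> G y -> GRing.comm x y -> G (x * y).
Proof.
move=> Gx Gy xy.
have -> : x * y = h ^+ 1 * ((x + y) ^+ 2 - x ^+ 2 - y ^+ 2).
  have -> : (x + y) ^+ 2 - x ^+ 2 - y ^+ 2 = x * y + x * y.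
    rewrite !expr2 mulrDl !mulrDr -xy.
    by rewrite addrA [LHS]addrAC addrK -(addrA (x * x)) [LHS]addrAC subrr add0r.
  by rewrite expr1 mulrDr halfK.
apply: dg_halfX; apply: dgB; first apply: dgB; apply/pos_dg/pos_sqr => //.
exact: dgD.
Qed.

(* The supremum [s] of [- h ^+ n] satisfies [s <= s + s]. *)
Lemma archimedean a : G a -> (forall n, Pos (h ^+ n - a)) -> Pos (- a).
Proof.
move=> Ga ale; have [_ _ cv] := hAH.
have Ghn n : G (h ^+ n) by rewrite -[h ^+ n]mulr1; exact: dg_halfX dg1.
have hS n : h ^+ n.+1 + h ^+ n.+1 = h ^+ n by rewrite exprS halfK.
have [|n|m n||s [Gs sub slub] _] := cv (fun n => - h ^+ n).
- by move=> n; exact: dgN.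
- rewrite /dg_le opprK addrC -[X in X - _]hS addrK -[h ^+ _]mulr1.
  exact: pos_halfX pos1.
- by apply: commrN; exact/commr_sym/commrN/comm_halfX.
- exists 0 => [|n]; first exact: dg0.
  by rewrite /dg_le sub0r opprK -[h ^+ _]mulr1; exact: pos_halfX pos1.
(* Each [- h ^+ n] is twice [- h ^+ n.+1], so [s + s] is an upper bound as well. *)
have Ps : Pos s.
  have := slub (s + s) (dgD Gs Gs); rewrite /dg_le addrK; apply=> n.
  by rewrite opprK -hS addrACA; apply: posD; rewrite -[h ^+ _]opprK; exact: sub.
have /(posD Ps) : dg_le E s (- a); last by rewrite addrC subrK.
by apply: slub => [|n]; [exact: dgN|rewrite /dg_le opprK addrC].
Qed.

End Half.

(** * The bicommutant of a single element *)

Lemma bicommutant_sub A g : A `<=` G -> A g -> CC A g.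
Proof.
move=> AG Ag; split=> [|z [_ Cz]]; first exact: AG.
exact/commr_sym/Cz.
Qed.

(** Since [e] lies in [C(e)], all of [CC(e)] lies in [C(e)] and hence commutes with [CC(e)]. Through
    [dgM], this commutativity keeps products in [G]. *)
Lemma bicommutant_csub e : G e -> commutative_subring (CC [set e]).
Proof.
move=> Ge; have Ce : C [set e] e by split=> // _ ->.
have com x y : CC [set e] x -> CC [set e] y -> GRing.comm x y.
  move=> [Gx Cx] [Gy Cy]; apply: Cx; split=> // _ ->; exact: Cy.
have [h [Eh hh hC]] := half_exists.
split=> //; split=> [|x y|x y].
- apply/mem_set; split=> [|a _]; first exact: dg1.
  exact/commr_sym/commr1.
- move=> /set_mem[Gx Cx] /set_mem[Gy Cy]; apply/mem_set.
  split=> [|a Ca]; first exact: dgB.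
  by apply/commr_sym/commrB; apply: commr_sym; [exact: Cx|exact: Cy].
- move=> /set_mem Sx /set_mem Sy; apply/mem_set; have [[Gx Cx] [Gy Cy]] := (Sx, Sy).
  split=> [|a Ca]; first by apply: (dgM Eh) => //; exact: com.
  by apply/commr_sym/commrM; apply: commr_sym; [exact: Cx|exact: Cy].
Qed.

Lemma bicommutant_cone e (Ge : G e) :
  monotone_complete_cone
    [set x : csub_type (bicommutant_csub Ge) | Pos (\val x)].
Proof.
have [h [Eh hh hC]] := half_exists; have [_ QA cv] := hAH.
have valG (x : csub_type (bicommutant_csub Ge)) : CC [set e] (\val x).
  exact/set_mem/(valP x).
split=> [a b|a b Pa Pb|a|a Pa Pa'|a aa0||u uS [b ub]].
- exact: posD.
- apply: (ering_mul hE) => //; exact: (csub_comm (bicommutant_csub Ge)).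
- by rewrite /mkset rmorphXn; apply: pos_sqr; have [] := valG a.
- by apply: val_inj; exact: pos_anti.
- apply: val_inj; rewrite rmorph0 -[LHS]mulr1.
  have [Ga _] := valG a.
  (* Quadratic annihilation against [1] rules out nilpotents. *)
  have [] // := QA _ _ Ga dg1.
  by rewrite expr1n mulr1 -expr2 -rmorphXn aa0 rmorph0.
- have Sh : CC [set e] h.
    by split=> [|z _]; [exact/pos_dg/effect_pos|exact/commr_sym/hC].
  exists (CSub (bicommutant_csub Ge) (mem_set Sh)).
  by apply: val_inj; rewrite rmorphD rmorph1.
- have [||m n||s [Gs sub slub] Cs] := cv (\val \o u).
  + by move=> n; have [] := valG (u n).
  + exact: uS.
  + by apply: (csub_comm (bicommutant_csub Ge)); exact: valG.
  + exists (\val b); [by have [] := valG b|exact: ub].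
  (* Each [u n] lies in [CC(e)], so [C(e)] is contained in [C(range u)], with which [s] commutes. *)
  have Ss : CC [set e] s.
    split=> // z [Gz Cz]; have [_] := Cs; apply; split=> // _ [n _ <-].
    by have [_ Cu] := valG (u n); apply/commr_sym/Cu.
  exists (CSub (bicommutant_csub Ge) (mem_set Ss)) => [n|c cle].
    exact: sub.
  by apply: slub; have [] := valG c.
Qed.

(** * Binary expansion of effects *)

Lemma effect_bisection e : E e ->
  exists c, [/\ P c, CC [set e] c & E (e + e - c)].
Proof.
move=> Ee; have Ge : G e by exact/pos_dg/effect_pos.
have See : CC [set e] e by apply: bicommutant_sub => // _ ->.
pose x := CSub (bicommutant_csub Ge) (mem_set See).
have [||c [cc Pc Pc']] := bisection_proj (bicommutant_cone Ge) (e := x).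
- exact: effect_pos.
- exact/effect_pos/(ering_compl hE).
have Sc : CC [set e] (\val c) by exact/set_mem/(valP c).
exists (\val c); split=> //.
  by split; [case: Sc|rewrite -rmorphXn expr2 cc].
exact: (ering_le1 hE Pc Pc').
Qed.

(* With [r n] the [n]-th remainder of the binary expansion of [e], the partial sums
   are [u n = e - r n / 2 ^ n]. *)
Lemma effect_comm e z : E e -> G z ->
  (forall p, P p -> CC [set e] p -> GRing.comm p z) -> GRing.comm e z.
Proof.
move=> Ee Gz Cz; have [h [Eh hh hC]] := half_exists; have [_ _ cv] := hAH.
have Ge : G e by exact/pos_dg/effect_pos.
have See : CC [set e] e by apply: bicommutant_sub => // _ ->.
(* The digit is made a total function, with the arbitrary value 0 outside [E]. *)
have /choice[c cP] x : exists c, E x -> [/\ P c, CC [set x] c & E (x + x - c)].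
  by have [/effect_bisection[c ?]|nEx] := pselect (E x); [exists c|exists 0].
pose r n := iter n (fun x => x + x - c x) e.
have Er n : E (r n) by elim: n => //= n /cP[].
have [Gcsub CsubC] := bicommutant_csub Ge.
have Sr n : CC [set e] (r n) /\ CC [set e] (c (r n)).
  (* For [x] in [CC(e)], [C(e)] is contained in [C(x)], hence [CC(x)] in [CC(e)]. *)
  have Sc x : E x -> CC [set e] x -> CC [set e] (c x).
    move=> /cP[_ [Gc Cc] _] [Gx Cx]; split=> // y Cy; apply: Cc.
    by split=> [|_ ->]; [case: Cy|exact/commr_sym/Cx].
  elim: n => [|n [IHr IHc]]; first by split=> //; exact: Sc.
  suff Sr : CC [set e] (r n.+1) by split=> //; exact: Sc.
  move: IHr IHc => [Gr Cr] [Gc Cc]; split=> [|y Cy]; first by apply: dgB => //; exact: dgD.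
  apply/commr_sym/commrB; last exact/commr_sym/Cc.
  by apply: commrD; exact/commr_sym/Cr.
pose u n := e - h ^+ n * r n.
have uS n : u n.+1 = u n + h ^+ n.+1 * c (r n).
  rewrite /u /= mulrBr mulrDr [h ^+ n.+1]exprS -!(mulrA h) (halfK hh) opprB.
  by rewrite addrCA addrC.
have Gu n : G (u n).
  by apply: dgB => //; apply: dg_halfX => //; exact/pos_dg/effect_pos.
have comm_u x n : (forall k, GRing.comm x (c (r k))) -> GRing.comm x (u n).
  move=> xc; elim: n => [|n IHn]; first by rewrite /u expr0 mul1r subrr; exact: commr0.
  rewrite uS; apply: commrD => //; apply: commrM => //; exact: commrX.
have [||m n||s [Gs sub slub] [_ Cs]] := cv u => //.
- move=> n; rewrite /dg_le uS addrAC subrr add0r; apply: pos_halfX => //.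
  by apply: proj_pos; have [] := cP _ (Er n).
- by apply: (comm_u) => k; apply/commr_sym; apply: comm_u => l; apply: CsubC; exact: (Sr _).2.
- exists e => // n; rewrite /dg_le subKr.
  by apply: pos_halfX => //; exact: effect_pos.
have es : e = s.
  apply/eqP; rewrite -subr_eq0; apply/eqP; apply: pos_anti.
    apply: slub => // n; rewrite /dg_le subKr.
    by apply: pos_halfX => //; exact: effect_pos.
  (* For every [n], [e - s <= e - u n = h ^+ n * r n <= h ^+ n]. *)
  apply: (archimedean Eh hh hC) => [|n]; first exact: dgB.
  have -> : h ^+ n - (e - s) = h ^+ n * (1 - r n) + (s - u n).
    by rewrite /u mulrBr mulr1 !opprB [s + _]addrCA [RHS]addrA subrK.
  apply: posD; last exact: sub.
  apply: pos_halfX => //; exact/effect_pos/(ering_compl hE).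
(* [z] commutes with all digits, hence with all partial sums, hence with [s]. *)
rewrite es; apply: Cs; split=> // _ [n _ <-]; apply: comm_u => k.
apply/commr_sym/Cz; last exact: (Sr _).2.
by have [] := cP _ (Er k).
Qed.

(** * From effects to all of [G] *)

Lemma pos_le_nat a : Pos a -> exists n, Pos (n%:R - a).
Proof.
move=> [s [Es ->]]; exists (size s).
elim: s Es => [|x s IHs] Es; first by rewrite big_nil subr0; exact: pos0.
rewrite big_cons /= mulrS opprD addrACA; apply: posD.
  by apply/effect_pos/(ering_compl hE)/Es; rewrite mem_head.
by apply: IHs => y ys; apply: Es; rewrite inE ys orbT.
Qed.

(** The bound is a power of two so that a power of [h] can scale it back. *)
Lemma dg_bounded g : G g ->
  exists n, Pos ((2 ^ n)%:R - g) /\ Pos ((2 ^ n)%:R + g).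
Proof.
move=> [a [b [Pa Pb ->]]].
have [[k ka] [l lb]] := (pos_le_nat Pa, pos_le_nat Pb); exists (k + l)%N.
have le m x : (m <= k + l)%N -> Pos (m%:R - x) -> Pos ((2 ^ (k + l))%:R - x).
  move=> mkl Px; have m2 : (m <= 2 ^ (k + l))%N.
    exact: leq_trans mkl (ltnW (ltn_expl _ _)).
  by rewrite -(subnK m2) natrD -addrA; apply: posD => //; exact: pos_nat.
split; first by rewrite opprB addrA addrAC; apply: posD => //; exact: le (leq_addr _ _) ka.
by rewrite addrCA; apply: posD => //; exact: le (leq_addl _ _) lb.
Qed.

(** An affine change with central coefficients turns [g] into an effect [e]. As [C(g)] is contained
    in [C(e)], the projections of [CC(e)] are among those of [CC(g)], and [effect_comm] applies. *)
Lemma spectral_comm g z : G g -> G z ->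
  (forall p, P p -> CC [set g] p -> GRing.comm p z) -> GRing.comm g z.
Proof.
move=> Gg Gz Cz; have [h [Eh hh hC]] := half_exists.
have [n [Pg1 Pg2]] := dg_bounded Gg.
pose e := h ^+ n.+1 * ((2 ^ n)%:R + g).
have Ee : E e.
  apply: (ering_le1 hE); first exact: pos_halfX.
  suff -> : 1 - e = h ^+ n.+1 * ((2 ^ n)%:R - g) by exact: pos_halfX.
  rewrite /e -{1}(halfX_nat hh n.+1) expnS mul2n -addnn natrD -mulrBr.
  by rewrite opprD addrA addrK.
have gE : g = (2 ^ n.+1)%:R * e - (2 ^ n)%:R.
  rewrite /e mulrA -(commr_nat (h ^+ _) _) (halfX_nat hh) mul1r.
  by rewrite addrAC subrr add0r.
have commE x : GRing.comm x g -> GRing.comm x e.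
  move=> xg; apply: commrM; first exact/commrX/hC.
  by apply: commrD => //; exact: commr_nat.
suff ez : GRing.comm e z.
  rewrite gE; apply/commr_sym/commrB; last exact: commr_nat.
  by apply: commrM; [exact: commr_nat|exact: commr_sym].
apply: effect_comm => // p Pp [Gp Cp]; apply: Cz => //; split=> // y [Gy Cy].
by apply: Cp; split=> // _ ->; apply/commE/Cy.
Qed.

(** * Compatibility and commutation of projections *)

(** Compressing [p <= 1 - q] by [q] gives [0 <= q p q <= 0], and [ering_quad0] concludes. *)
Lemma orthogonal_mul0 p q : P p -> P q -> orthogonal_proj E p q ->
  p * q = 0 /\ q * p = 0.
Proof.
move=> Pp Pq pq; have [Gq qq] := Pq.
suff qpq0 : q * p * q = 0.
  by have [] := ering_quad0 hE (proj_pos Pq) (proj_pos Pp) qpq0.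
apply: pos_anti; first by apply: (ering_quad hE); exact: proj_pos.
have := ering_quad hE (proj_pos Pq) pq.
by rewrite !mulrBr !mulrBl mulr1 -expr2 -qq -expr2 -qq subrr sub0r.
Qed.

(** By orthogonality both products reduce to [r * r]. *)
Lemma compatible_comm p q : Mackey_compatible E p q -> GRing.comm p q.
Proof.
move=> [p1 [q1 [r [[Pp1 Pq1 Pr] [o1 o2 o3] [_ ->] [_ ->]]]]].
have [[[a b] [c d]] [f g]] :=
  (orthogonal_mul0 Pp1 Pq1 o1, orthogonal_mul0 Pp1 Pr o2, orthogonal_mul0 Pq1 Pr o3).
by rewrite /GRing.comm !mulrDl !mulrDr a b c d f g.
Qed.

Lemma projM p q : P p -> P q -> GRing.comm p q -> P (p * q).
Proof.
move=> [Gp pp] [Gq qq] pq; have [h [Eh hh hC]] := half_exists.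
by split; [exact: (dgM Eh)|rewrite exprMn_comm // -pp -qq].
Qed.

(* A projection [t] above [a] and [b] absorbs both, hence their sum, so
   [t - (a + b)] is idempotent. *)
Lemma sum_is_join a b : P a -> P b -> P (a + b) -> is_join_proj E a b (a + b).
Proof.
move=> Pa Pb Pab; split=> //; rewrite /dg_le.
- by rewrite addrAC subrr add0r; exact: proj_pos.
- by rewrite addrK; exact: proj_pos.
move=> t Pt at_ bt.
have absorb x : P x -> dg_le E x t -> x * t = x /\ t * x = x.
  move=> Px xt; have [|x0 x1] := orthogonal_mul0 Px (projC Pt).
    by rewrite /orthogonal_proj subKr.
  split; apply/eqP; rewrite eq_sym -subr_eq0.
    by rewrite -[X in X - _]mulr1 -mulrBr x0.
  by rewrite -[X in X - _]mul1r -mulrBl x1.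
have [at1 at2] := absorb _ Pa at_; have [bt1 bt2] := absorb _ Pb bt.
apply: proj_pos; have [[Gt tt] [Gab abab]] := (Pt, Pab).
split; first exact: dgB.
rewrite expr2 mulrBl mulrBr -expr2 -tt [t * _]mulrDr at2 bt2.
by rewrite mulrBr -[(a + b) * (a + b)]expr2 -abab mulrDl at1 bt1 subrr subr0.
Qed.

Lemma comm_compatible p q : P p -> P q -> GRing.comm p q -> Mackey_compatible E p q.
Proof.
move=> Pp Pq pq.
have cpq : GRing.comm p (1 - q) by apply: commrB => //; exact: commr1.
have cqp : GRing.comm q (1 - p) by apply: commrB => //; exact: commr1.
have Pp1 : P (p * (1 - q)) by apply: projM => //; exact: projC.
have Pq1 : P (q * (1 - p)) by apply: projM => //; exact: projC.
have Pr : P (p * q) by exact: projM.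
have Ep : p * (1 - q) + p * q = p by rewrite -mulrDr subrK mulr1.
have Eq : q * (1 - p) + p * q = q by rewrite pq -mulrDr subrK mulr1.
have Pnn : Pos ((1 - p) * (1 - q)).
  apply/proj_pos/projM; [exact: projC..|].
  by apply: commrB; [exact: commr1|apply/commr_sym/commrB; [exact: commr1|]].
exists (p * (1 - q)), (q * (1 - p)), (p * q); split=> //; last first.
- by split=> //; rewrite -[X in is_join_proj _ _ _ X]Eq; apply: sum_is_join => //; rewrite Eq.
- by split=> //; rewrite -[X in is_join_proj _ _ _ X]Ep; apply: sum_is_join => //; rewrite Ep.
split; rewrite /orthogonal_proj /dg_le.
(* The complement of the symmetric difference of [p] and [q], as a sum of two projections. *)
- suff -> : 1 - q * (1 - p) - p * (1 - q) = (1 - p) * (1 - q) + p * q.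
    by apply: posD => //; exact: proj_pos.
  have -> : (1 - p) * (1 - q) = 1 - (q * (1 - p) + p * q) - p * (1 - q).
    by rewrite Eq mulrBl mul1r.
  by rewrite opprD addrA [RHS]addrAC subrK.
- suff -> : 1 - p * q - p * (1 - q) = 1 - p by exact/proj_pos/projC.
  by rewrite -addrA -opprD addrC [in X in - X]addrC Ep addrC.
- suff -> : 1 - p * q - q * (1 - p) = 1 - q by exact/proj_pos/projC.
  by rewrite -addrA -opprD addrC [in X in - X]addrC Eq addrC.
Qed.

(** * Maximal commuting sets, blocks and C-blocks *)

(** An element of [C(H)] can be adjoined to a commuting [H], so maximality amounts to [C(H)] lying
    in [H]. *)
Lemma maximal_commutant H : maximal_set (pairwise_commuting E) H <-> H = C H.
Proof.
split=> [[[HG Hcomm] Hmax]|HC].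
  rewrite eqEsubset; split=> [g Hg|g [Gg Cg]].
    by split=> [|k Hk]; [exact: HG|exact: Hcomm].
  apply: (Hmax (H `|` [set g])); [|by left|by right].
  split=> [x [/HG//|->//]|x y [Hx|->] [Hy|->]//].
  - exact: Hcomm.
  - exact/commr_sym/Cg.
  - exact: Cg.
split=> [|K [KG Kcomm] HK k Kk].
  split=> [g|g k Hg Hk]; first by rewrite HC => -[].
  by move: Hg; rewrite HC => -[_]; exact.
by rewrite HC; split=> [|x /HK Kx]; [exact: KG|exact: Kcomm].
Qed.

(** The same adjunction argument, with compatibility traded for commutation. *)
Lemma block_commutant B : is_block E B <-> B = C B `&` P.
Proof.
split=> [[[BP Bcomp] Bmax]|BC].
  rewrite eqEsubset; split=> [p Bp|p [[Gp Cp] Pp]].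
    split; last exact: BP.
    split=> [|q Bq]; first by have [] := BP _ Bp.
    exact/compatible_comm/Bcomp.
  apply: (Bmax (B `|` [set p])); [|by left|by right].
  split=> [x [/BP//|->//]|x y [Bx|->] [By|->]].
  - exact: Bcomp.
  - by apply: comm_compatible => //; [exact: BP|exact/commr_sym/Cp].
  - by apply: comm_compatible => //; [exact: BP|exact: Cp].
  - exact: comm_compatible.
have BP : B `<=` P by rewrite BC => p [].
split=> [|K [KP Kcomp] BK p Kp].
  split=> // p q Bp Bq; apply: comm_compatible; [exact: BP..|].
  by move: Bp; rewrite {1}BC => -[[_ Cp] _]; exact: Cp.
rewrite BC; split; last exact: KP.
split=> [|q /BK Kq]; first by have [] := KP _ Kp.
exact/compatible_comm/Kcomp.
Qed.

Lemma commutant_zmod_closed A : zmod_closed [in C A].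
Proof.
split=> [|x y /set_mem[Gx Cx] /set_mem[Gy Cy]]; apply/mem_set.
  by split=> [|a _]; [exact: dg0|exact/commr_sym/commr0].
split=> [|a Aa]; first exact: dgB.
by apply/commr_sym/commrB; apply: commr_sym; [exact: Cx|exact: Cy].
Qed.

Lemma C_block_maximal_commuting H :
  is_C_block E H <-> maximal_set (pairwise_commuting E) H.
Proof.
rewrite maximal_commutant; split=> [[_ [B /block_commutant BC ->]]|HC].
  have BG : B `<=` C B by rewrite {1}BC => p [].
  rewrite eqEsubset; split=> [g [Gg Cg]|g [Gg Cg]]; last first.
    by split=> // p /BG/Cg.
  split=> // z [Gz Cz]; apply: spectral_comm => // p Pp [Gp Cp].
  (* [g] commutes with [B], so a projection in [CC(g)] also does, and therefore belongs to [B]. *)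
  apply/commr_sym/Cz; rewrite BC; split=> //; split=> // q Bq.
  apply: Cp; split=> [|_ ->]; first by have [] := BG _ Bq.
  exact/commr_sym/Cg.
(* Every element of [H = C(H)] lies in [C(g)], so [CC(g)] commutes with [H]. *)
have spectral g p : H g -> CC [set g] p -> H p.
  move=> Hg [Gp Cp]; rewrite HC; split=> // x; rewrite {1}HC => -[Gx Cx].
  by apply: Cp; split=> // _ ->; exact: Cx.
have HG : H `<=` G by rewrite HC => g [].
have commH z : G z -> (forall p, (H `&` P) p -> GRing.comm z p) -> H z.
  move=> Gz Cz; rewrite HC; split=> // g Hg; apply/commr_sym.
  apply: spectral_comm => // [|p Pp Sp]; first exact: HG.
  by apply/commr_sym/Cz; split=> //; exact: spectral Sp.
have HCH : H = C (H `&` P).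
  rewrite eqEsubset; split=> [g|g [Gg Cg]]; last exact: commH.
  by rewrite {1}HC => -[Gg Cg]; split=> // p [/Cg].
split; first by rewrite HC; exact: commutant_zmod_closed.
(* As [C(H & P) = H], the block equation for [H & P] becomes an identity. *)
by exists (H `&` P) => //; apply/block_commutant; rewrite -HCH.
Qed.

End ERingTheory.

Theorem theorem8p2 (R : nzRingType) (E : set R) (hE : is_ering E)
    (hAH : is_AH_algebra E) (H : set R) (hH : H `<=` directed_group E) :
  is_C_block E H <-> maximal_set (pairwise_commuting E) H.
Proof. exact: C_block_maximal_commuting. Qed.
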